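(* Consider the Stackelberg Q-value iteration $(Q^1_k,Q^2_k)_{k\ge 0}$ for a two-player general-sum Markov game with discount factor $\gamma\in[0,1)$, and let $(Q^1_*,Q^2_* )$ with policies $(a_*,b_* )$ be a Stackelberg fixed point (all as defined in the context). Assume $|r^i(s,a,b)|\le 1$ for all $(s,a,b)\in\mathcal S\times\mathcal A\times\mathcal B$ and $i\in\{1,2\}$, and $\|Q^1_0\|_\infty\le 1$, $\|Q^2_0\|_\infty\le 1$. Then there exists $\epsilon>0$ such that for every state $s\in\mathcal S$, all policies $\mu^1:\mathcal S\to\mathcal A$, $\mu^2:\mathcal S\to\mathcal B$, and every $k\ge 0$, $$Q^1_k(s,a_k(s),b_k(s,a_k(s)))\le Q^1_k(s,a_k(s),\mu^2(s))+\epsilon,$$ $$Q^2_k(s,a_k(s),b_k(s,a_k(s)))\le Q^2_k(s,\mu^1(s),b_k(s,a_k(s)))+\epsilon,$$ $$Q^1_*(s,a_*(s),b_*(s,a_*(s)))\le Q^1_*(s,a_*(s),\mu^2(s))+\epsilon,$$ $$Q^2_*(s,a_*(s),b_*(s,a_*(s)))\le Q^2_*(s,\mu^1(s),b_*(s,a_*(s)))+\epsilon.$$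
   Context: $\mathcal S$, $\mathcal A$, $\mathcal B$ are nonempty finite sets (states, leader actions, follower actions). $P(\cdot\mid s,a,b)$ is a probability distribution on $\mathcal S$ for each $(s,a,b)\in\mathcal S\times\mathcal A\times\mathcal B$. $r^1,r^2:\mathcal S\times\mathcal A\times\mathcal B\to\mathbb R$ are the reward functions of the leader (player 1) and follower (player 2), and $\gamma\in[0,1)$ is the discount factor. For $Q:\mathcal S\times\mathcal A\times\mathcal B\to\mathbb R$, $\|Q\|_\infty=\max_{s,a,b}|Q(s,a,b)|$. Stackelberg Q-value iteration: starting from $Q^1_0,Q^2_0:\mathcal S\times\mathcal A\times\mathcal B\to\mathbb R$, for each $k\ge 0$ define $$b_k(s,a)\in\arg\max_{b\in\mathcal B}Q^2_k(s,a,b),\qquad a_k(s)\in\arg\max_{a\in\mathcal A}Q^1_k(s,a,b_k(s,a)),$$ and $$Q^1_{k+1}(s,a,b)=r^1(s,a,b)+\gamma\sum_{s'\in\mathcal S}P(s'\mid s,a,b)\max_{a'\in\mathcal A}Q^1_k(s',a',b_k(s',a')),$$ $$Q^2_{k+1}(s,a,b)=r^2(s,a,b)+\gamma\sum_{s'\in\mathcal S}P(s'\mid s,a,b)\max_{b'\in\mathcal B}Q^2_k(s',a_k(s'),b').$$ Stackelberg fixed point: functions $Q^1_*,Q^2_*:\mathcal S\times\mathcal A\times\mathcal B\to\mathbb R$ together with policies $$b_*(s,a)\in\arg\max_{b\in\mathcal B}Q^2_*(s,a,b),\qquad a_*(s)\in\arg\max_{a\in\mathcal A}Q^1_*(s,a,b_*(s,a)),$$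 satisfying $$Q^1_*(s,a,b)=r^1(s,a,b)+\gamma\sum_{s'\in\mathcal S}P(s'\mid s,a,b)\,Q^1_*(s',a_*(s'),b_*(s',a_*(s'))),$$ $$Q^2_*(s,a,b)=r^2(s,a,b)+\gamma\sum_{s'\in\mathcal S}P(s'\mid s,a,b)\,Q^2_*(s',a_*(s'),b_*(s',a_*(s'))).$$ Standing convention: all the $\arg\max$'s above are assumed to have a unique maximizer. *)

(* Defs.v *)
From mathcomp Require Import all_boot all_order all_algebra.
From mathcomp Require Import reals.

Set Implicit Arguments.
Unset Strict Implicit.
Unset Printing Implicit Defensive.

Import Order.TTheory GRing.Theory Num.Theory.
Local Open Scope ring_scope.

(* The seed [F t0] of the iterated max is itself one of the values of F, so for
   nonempty T this is the true maximum, negative values included (see fmaxP).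
   The value 0 is junk, used only when T is empty. *)
Definition fmax (R : realType) (T : finType) (F : T -> R) : R :=
  if [pick t : T] is Some t0 then \big[Num.max/F t0]_(t : T) F t else 0.

Lemma fmaxP (R : realType) (T : finType) (F : T -> R) :
  (0 < #|T|)%N -> (exists t, F t = fmax F) /\ (forall t, F t <= fmax F).
Proof.
move=> T_gt0; rewrite /fmax; case: pickP => [t0 _|T0]; last first.
  by move: T_gt0; rewrite (eq_card0 T0).
split; last by move=> t; apply: le_bigmax_cond.
apply: (big_ind (fun x => exists t, F t = x)) => [|x y [t <-] [u <-]|t _].
- by exists t0.
- by rewrite /Num.max; case: ifP => _; [exists u | exists t].
- by exists t.
Qed.

Definition is_argmax (R : realType) (T : finType) (F : T -> R) (t : T) : Prop :=
  forall u : T, F u <= F t.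

Definition supnorm (R : realType) (S A B : finType) (Q : S -> A -> B -> R) : R :=
  fmax (fun x : S * A * B => `|Q x.1.1 x.1.2 x.2|).

(* P s a b s' stands for P(s' | s, a, b). *)
Definition is_transition_kernel (R : realType) (S A B : finType)
    (P : S -> A -> B -> S -> R) : Prop :=
  forall s a b,
    (forall s', 0 <= P s a b s') /\ \sum_(s' : S) P s a b s' = 1.

(* [unique X x] says that x satisfies X and is the only one to do so: it
   expresses both membership in the arg max and the standing convention that
   maximizers are unique. *)
Definition stackelberg_policies (R : realType) (S A B : finType)
    (Q1 Q2 : S -> A -> B -> R) (a : S -> A) (b : S -> A -> B) : Prop :=
  (forall s x, unique (is_argmax (fun y => Q2 s x y)) (b s x)) /\
  (forall s, unique (is_argmax (fun x => Q1 s x (b s x))) (a s)).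

Definition stackelberg_iteration (R : realType) (S A B : finType)
    (P : S -> A -> B -> S -> R) (r1 r2 : S -> A -> B -> R) (gamma : R)
    (Q1 Q2 : nat -> S -> A -> B -> R)
    (a : nat -> S -> A) (b : nat -> S -> A -> B) : Prop :=
  forall k : nat,
    [/\ stackelberg_policies (Q1 k) (Q2 k) (a k) (b k),
        forall s x y, Q1 k.+1 s x y = r1 s x y +
          gamma * \sum_(s' : S)
            P s x y s' * fmax (fun x' : A => Q1 k s' x' (b k s' x')) &
        forall s x y, Q2 k.+1 s x y = r2 s x y +
          gamma * \sum_(s' : S)
            P s x y s' * fmax (fun y' : B => Q2 k s' (a k s') y')].

Definition stackelberg_fixed_point (R : realType) (S A B : finType)
    (P : S -> A -> B -> S -> R) (r1 r2 : S -> A -> B -> R) (gamma : R)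
    (Q1 Q2 : S -> A -> B -> R) (a : S -> A) (b : S -> A -> B) : Prop :=
  [/\ stackelberg_policies Q1 Q2 a b,
      forall s x y, Q1 s x y = r1 s x y +
        gamma * \sum_(s' : S) P s x y s' * Q1 s' (a s') (b s' (a s')) &
      forall s x y, Q2 s x y = r2 s x y +
        gamma * \sum_(s' : S) P s x y s' * Q2 s' (a s') (b s' (a s'))].

(* Main.v *)
(* Rewards bounded by 1 confine every Q-value to [-C, C] with C = 1/(1-gamma),
   because C = 1 + gamma C: by induction on k for the iterates, and by evaluating
   the fixed-point equation where |Q| is maximal for the fixed point. Two Q-values
   of the same player thus differ by at most eps = 2C. *)

Require Import Defs.
From mathcomp Require Import all_boot all_order all_algebra.
From mathcomp Require Import reals ring lra.

Set Implicit Arguments.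
Unset Strict Implicit.
Unset Printing Implicit Defensive.

Import Order.TTheory GRing.Theory Num.Theory.
Local Open Scope ring_scope.

(** Over a nonempty type the maximum is attained, so it inherits any bound on the values. *)
Lemma norm_fmax_le (R : realType) (T : finType) (F : T -> R) (C : R) :
  (0 < #|T|)%N -> (forall t, `|F t| <= C) -> `|fmax F| <= C.
Proof. by move=> T_gt0 F_le; have [[t <-] _] := fmaxP F T_gt0. Qed.

Lemma norm_le_supnorm (R : realType) (S A B : finType) (Q : S -> A -> B -> R)
    (s : S) (x : A) (y : B) :
  `|Q s x y| <= supnorm Q.
Proof.
have T_gt0 : (0 < #|{: S * A * B}|)%N by apply/card_gt0P; exists (s, x, y).
by have [_ /(_ (s, x, y))] :=
  fmaxP (fun u : S * A * B => `|Q u.1.1 u.1.2 u.2|) T_gt0.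
Qed.

(** The expectation of [v] under a probability distribution stays within any bound on [|v|]. *)
Lemma norm_bellman_le (R : realType) (S A B : finType)
    (P : S -> A -> B -> S -> R) (r : S -> A -> B -> R) (gamma C : R)
    (v : S -> R) :
  is_transition_kernel P -> 0 <= gamma ->
  (forall s x y, `|r s x y| <= 1) -> (forall s, `|v s| <= C) ->
  forall s x y,
    `|r s x y + gamma * \sum_(s' : S) P s x y s' * v s'| <= 1 + gamma * C.
Proof.
move=> P_kernel gamma_ge0 r_le1 v_leC s x y; have [P_ge0 P_sum1] := P_kernel s x y.
rewrite (le_trans (ler_normD _ _)) // lerD // normrM ger0_norm //.
rewrite ler_wpM2l // (le_trans (ler_norm_sum _ _ _)) //.
(* [C] is spread out as the sum of [P s x y s' * C], for a termwise comparison. *)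
rewrite -[leRHS]mul1r -P_sum1 mulr_suml ler_sum // => s' _.
by rewrite normrM ger0_norm // ler_wpM2l.
Qed.

Lemma discounted_horizon_fixed (R : realType) (gamma : R) :
  gamma < 1 -> 1 + gamma * (1 - gamma)^-1 = (1 - gamma)^-1.
Proof.
move=> gamma_lt1; have d_neq0 : 1 - gamma != 0 by rewrite subr_eq0 gt_eqF.
by field.
Qed.

(** The sequence [v] abstracts the continuation value, since leader and follower back up different
    maxima; the induction uses only that [v k] inherits bounds on [Q k]. *)
Lemma norm_value_iteration_le (R : realType) (S A B : finType)
    (P : S -> A -> B -> S -> R) (r : S -> A -> B -> R) (gamma : R)
    (Q : nat -> S -> A -> B -> R) (v : nat -> S -> R) :
  is_transition_kernel P -> 0 <= gamma -> gamma < 1 ->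
  (forall s x y, `|r s x y| <= 1) -> supnorm (Q 0%N) <= 1 ->
  (forall k s x y,
     Q k.+1 s x y = r s x y + gamma * \sum_(s' : S) P s x y s' * v k s') ->
  (forall k C, (forall s x y, `|Q k s x y| <= C) -> forall s, `|v k s| <= C) ->
  forall k s x y, `|Q k s x y| <= (1 - gamma)^-1.
Proof.
move=> P_kernel gamma_ge0 gamma_lt1 r_le1 Q0_le1 QS v_le.
elim=> [|k IHk] s x y; last first.
  by rewrite QS -discounted_horizon_fixed // norm_bellman_le //; apply: v_le.
apply: le_trans (norm_le_supnorm _ _ _ _) (le_trans Q0_le1 _).
(* Base case: [1 <= (1 - gamma)^-1], because [0 < 1 - gamma <= 1]. *)
by rewrite invf_ge1 ?subr_gt0 // gerBl.
Qed.

(** With [M = supnorm Q], the equation at a triple where [|Q|] equals [M] gives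
    [M <= 1 + gamma * M]. Here [b] is the follower's reply along the leader's policy, hence a
    function of the state alone. *)
Lemma norm_bellman_fixpoint_le (R : realType) (S A B : finType)
    (P : S -> A -> B -> S -> R) (r : S -> A -> B -> R) (gamma : R)
    (Q : S -> A -> B -> R) (a : S -> A) (b : S -> B) :
  is_transition_kernel P -> 0 <= gamma -> gamma < 1 ->
  (forall s x y, `|r s x y| <= 1) ->
  (forall s x y, Q s x y =
     r s x y + gamma * \sum_(s' : S) P s x y s' * Q s' (a s') (b s')) ->
  forall s x y, `|Q s x y| <= (1 - gamma)^-1.
Proof.
move=> P_kernel gamma_ge0 gamma_lt1 r_le1 QE s x y.
apply: le_trans (norm_le_supnorm _ _ _ _) _.
have T_gt0 : (0 < #|{: S * A * B}|)%N by apply/card_gt0P; exists (s, x, y).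
have [[[[s0 x0] y0] /= Q_max] _] :=
  fmaxP (fun u : S * A * B => `|Q u.1.1 u.1.2 u.2|) T_gt0.
have Q_le : supnorm Q <= 1 + gamma * supnorm Q.
  rewrite {1}/supnorm -Q_max QE norm_bellman_le // => s'.
  exact: norm_le_supnorm.
rewrite -[leRHS]mul1r ler_pdivlMr ?subr_gt0 //.
lra.
Qed.

Lemma le_addr_norm_bound (R : realType) (u v C : R) :
  `|u| <= C -> `|v| <= C -> u <= v + 2 * C.
Proof. rewrite !ler_norml => /andP[_ uC] /andP[vC _]; lra. Qed.

Theorem mainTheorem2 (R : realType) (S A B : finType)
    (S_nonempty : (0 < #|S|)%N) (A_nonempty : (0 < #|A|)%N)
    (B_nonempty : (0 < #|B|)%N)
    (P : S -> A -> B -> S -> R) (r1 r2 : S -> A -> B -> R) (gamma : R)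
    (P_kernel : is_transition_kernel P)
    (gamma_ge0 : 0 <= gamma) (gamma_lt1 : gamma < 1)
    (Q1 Q2 : nat -> S -> A -> B -> R)
    (a : nat -> S -> A) (b : nat -> S -> A -> B)
    (iteration : stackelberg_iteration P r1 r2 gamma Q1 Q2 a b)
    (Q1star Q2star : S -> A -> B -> R) (astar : S -> A) (bstar : S -> A -> B)
    (fixed_point :
       stackelberg_fixed_point P r1 r2 gamma Q1star Q2star astar bstar)
    (r1_le1 : forall s x y, `|r1 s x y| <= 1)
    (r2_le1 : forall s x y, `|r2 s x y| <= 1)
    (Q1_0_le1 : supnorm (Q1 0%N) <= 1) (Q2_0_le1 : supnorm (Q2 0%N) <= 1) :
  exists eps : R, 0 < eps /\
    forall (s : S) (mu1 : S -> A) (mu2 : S -> B) (k : nat),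
      [/\ Q1 k s (a k s) (b k s (a k s)) <= Q1 k s (a k s) (mu2 s) + eps,
          Q2 k s (a k s) (b k s (a k s))
            <= Q2 k s (mu1 s) (b k s (a k s)) + eps,
          Q1star s (astar s) (bstar s (astar s))
            <= Q1star s (astar s) (mu2 s) + eps &
          Q2star s (astar s) (bstar s (astar s))
            <= Q2star s (mu1 s) (bstar s (astar s)) + eps].
Proof.
have Q1_le : forall k s x y, `|Q1 k s x y| <= (1 - gamma)^-1.
  apply: (norm_value_iteration_le P_kernel gamma_ge0 gamma_lt1 r1_le1 Q1_0_le1).
    by move=> k; have [_ Q1S _] := iteration k; exact: Q1S.
  by move=> k C QC s; apply: norm_fmax_le.
have Q2_le : forall k s x y, `|Q2 k s x y| <= (1 - gamma)^-1.
  apply: (norm_value_iteration_le P_kernel gamma_ge0 gamma_lt1 r2_le1 Q2_0_le1).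
    by move=> k; have [_ _ Q2S] := iteration k; exact: Q2S.
  by move=> k C QC s; apply: norm_fmax_le.
have [_ Q1E Q2E] := fixed_point.
(* Unification takes the state policy [b] to be [fun s => bstar s (astar s)]. *)
have Q1star_le :=
  norm_bellman_fixpoint_le P_kernel gamma_ge0 gamma_lt1 r1_le1 Q1E.
have Q2star_le :=
  norm_bellman_fixpoint_le P_kernel gamma_ge0 gamma_lt1 r2_le1 Q2E.
(* The witness depends on [gamma] alone, hence is uniform in the state, the policies and [k]. *)
exists (2 * (1 - gamma)^-1); split.
  by rewrite mulr_gt0 // invr_gt0 subr_gt0.
by move=> s mu1 mu2 k; split; apply: le_addr_norm_bound.
Qed.
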